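(* Let $n\ge 3$ and $d\ge 1$ be integers and let $0<\theta\le \pi$. Put $I=[-1,\cos\theta]$ and $$D=\{(u,v,t)\in\mathbb{R}^3 : -1\le u\le v\le t\le\cos\theta,\ 1+2uvt-u^2-v^2-t^2\ge 0\}.$$ Suppose that real numbers $a_1,\dots,a_d$, $b_{11},b_{12},b_{22}$ and real symmetric matrices $F_0,\dots,F_d$, where $F_k$ has size $(d-k+1)\times(d-k+1)$, satisfy (i) $\begin{pmatrix} b_{11}&b_{12}\\ b_{12}&b_{22}\end{pmatrix}\succeq 0$; (ii) $a_k\ge 0$ for $k=1,\dots,d$; (iii) $F_k\succeq 0$ for $k=0,\dots,d$; (iv) $\displaystyle\sum_{k=1}^d a_kP_k^n(u)+2b_{12}+b_{22}+3\sum_{k=0}^d\langle F_k,S_k^n(u,u,1)\rangle\le -1$ for all $u\in I$; (v) $\displaystyle b_{22}+\sum_{k=0}^d\langle F_k,S_k^n(u,v,t)\rangle\le 0$ for all $(u,v,t)\in D$. Then $$A(n,\theta)\le 1+\sum_{k=1}^d a_k+b_{11}+\langle F_0,S_0^n(1,1,1)\rangle .$$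
   Context: Notation. $S^{n-1}$ is the unit sphere of $\mathbb{R}^n$, $x\cdot y$ the standard inner product. $A(n,\theta)=\max\{\mathrm{card}(C): C\subset S^{n-1},\ c\cdot c'\le\cos\theta \text{ for all } c,c'\in C,\ c\ne c'\}$. $M\succeq 0$ means that the symmetric real matrix $M$ is positive semidefinite, and $\langle A,B\rangle=\mathrm{Trace}(AB)$ for symmetric matrices. Polynomials $P_k^m$. For $m\ge 3$, $P_k^m(t)=C_k^{m/2-1}(t)/C_k^{m/2-1}(1)$, where the Gegenbauer polynomials are given by $C_0^\lambda=1$, $C_1^\lambda(t)=2\lambda t$, $kC_k^\lambda(t)=2(k+\lambda-1)tC_{k-1}^\lambda(t)-(k+2\lambda-2)C_{k-2}^\lambda(t)$ for $k\ge2$. For $m=2$, $P_k^2=T_k$ is the Chebyshev polynomial of the first kind: $T_0=1$, $T_1(t)=t$, $T_k(t)=2tT_{k-1}(t)-T_{k-2}(t)$. Thus $P_k^m$ has degree $k$ and $P_k^m(1)=1$. Constants. $\omega_m=2\pi^{m/2}/\Gamma(m/2)$ is the surface area of $S^{m-1}$, and $h_k^m=\binom{m+k-1}{m-1}-\binom{m+k-3}{m-1}$ (with $\binom{a}{b}=0$ if $a<b$) is the dimension of the space of homogeneous harmonic polynomials of degree $k$ in $m$ variables. Matrices. For $0\le k\le d$, $Y_k^n(u,v,t)$ is the $(d-k+1)\times(d-k+1)$ matrix with entries, for $0\le i,j\le d-k$, $$(Y_k^n)_{i,j}(u,v,t)=\lambda_{i,j}\,P_i^{n+2k}(u)\,P_j^{n+2k}(v)\,Q_k^{n-1}(u,v,t),$$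 where $$Q_k^{n-1}(u,v,t)=\big((1-u^2)(1-v^2)\big)^{k/2}P_k^{n-1}\Big(\frac{t-uv}{\sqrt{(1-u^2)(1-v^2)}}\Big)$$ (this is a polynomial in $u,v,t$, and is understood as such everywhere) and $$\lambda_{i,j}=\frac{\omega_n}{\omega_{n-1}}\frac{\omega_{n+2k-1}}{\omega_{n+2k}}\big(h_i^{n+2k}h_j^{n+2k}\big)^{1/2}$$ (depending also on $n,k$). The matrix $S_k^n(u,v,t)$ is the symmetrization $S_k^n=\frac16\sum_\sigma\sigma Y_k^n$, where $\sigma$ runs over all six permutations of the variables $u,v,t$, acting entrywise on the polynomial entries. *)

(* Defs.v *)
From HB Require Import structures.
From mathcomp Require Import all_boot all_order all_algebra.
From mathcomp Require Import all_classical all_reals all_analysis.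
From mathcomp Require Import ring lra.

Set Implicit Arguments.
Unset Strict Implicit.
Unset Printing Implicit Defensive.

Import Order.TTheory GRing.Theory Num.Theory.
Local Open Scope classical_set_scope.
Local Open Scope card_scope.
Local Open Scope ring_scope.

Section SphericalCodes.
Variable R : realType.
Implicit Types (n : nat) (theta : R).

Definition dotp n (x y : 'rV[R]_n) : R := \sum_i x 0 i * y 0 i.

(* sphere n is S^{n-1}. *)
Definition sphere n : set 'rV[R]_n := [set x | dotp x x = 1].

Definition spherical_code n theta (C : set 'rV[R]_n) : Prop :=
  C `<=` @sphere n /\
  (forall c c', C c -> C c' -> c <> c' -> dotp c c' <= cos theta).

Definition is_max_code_card n theta (N : nat) : Prop :=
  (exists2 C, @spherical_code n theta C & C #= `I_N) /\
  (forall C, @spherical_code n theta C -> C #<= `I_N).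

(* The default value 0 is never taken when 0 < theta <= pi: see max_code_cardP. *)
Definition max_code_card n theta : nat := xget 0%N [set N | is_max_code_card n theta N].

End SphericalCodes.

Section SymmetricMatrices.
Variable R : realType.

Definition psdmx n (M : 'M[R]_n) : Prop :=
  M^T = M /\ forall x : 'rV[R]_n, 0 <= (x *m M *m x^T) 0 0.

Definition mxdot n (A B : 'M[R]_n) : R := \tr (A *m B).

End SymmetricMatrices.

Section Polynomials.
Variable R : realType.

Fixpoint gegenbauer (lambda : R) (k : nat) {struct k} : {poly R} :=
  match k with
  | 0 => 1
  | k1.+1 =>
    match k1 with
    | 0 => (2 * lambda) *: 'X
    | k2.+1 =>
      k%:R^-1 *: ((2 * (k%:R + lambda - 1)) *: ('X * gegenbauer lambda k1)
                  - (k%:R + 2 * lambda - 2) *: gegenbauer lambda k2)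
    end
  end.

Fixpoint chebyshev (k : nat) {struct k} : {poly R} :=
  match k with
  | 0 => 1
  | k1.+1 =>
    match k1 with
    | 0 => 'X
    | k2.+1 => 2 *: ('X * chebyshev k1) - chebyshev k2
    end
  end.

(* normGegenbauer m k is P_k^m, for m >= 2. *)
Definition normGegenbauer (m k : nat) : {poly R} :=
  if m == 2%N then chebyshev k
  else let C := gegenbauer (m%:R / 2 - 1) k in C.[1]^-1 *: C.

(* Q m k is Q_k^m as a polynomial function: P_k^m has the parity of k, so in
     ((1-u^2)(1-v^2))^{k/2} P_k^m((t-uv) / sqrt((1-u^2)(1-v^2)))
   only the powers ((1-u^2)(1-v^2))^{(k-j)/2} with k-j even occur.  This is
   the polynomial extension of that expression to u, v = +-1, where the
   quotient is undefined; see QE. *)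
Definition Q (m k : nat) (u v t : R) : R :=
  \sum_(j < k.+1) (normGegenbauer m k)`_j * (t - u * v) ^+ j
                  * ((1 - u ^+ 2) * (1 - v ^+ 2)) ^+ (k - j)./2.

End Polynomials.

Section Matrices.
Variable R : realType.

Definition Gamma (x : R) : R :=
  Rintegral lebesgue_measure `]0, +oo[ (fun t : R => t `^ (x - 1) * expR (- t)).

Definition omega (m : nat) : R := 2 * pi `^ (m%:R / 2) / Gamma (m%:R / 2).

(* Only used for m >= 3, where truncating m + k - 3 is harmless. *)
Definition harmdim (m k : nat) : R :=
  ('C(m + k - 1, m - 1))%:R - ('C(m + k - 3, m - 1))%:R.

Definition lambdaY (n k i j : nat) : R :=
  omega n / omega (n - 1) * (omega (n + 2 * k - 1) / omega (n + 2 * k))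
  * Num.sqrt (harmdim (n + 2 * k) i * harmdim (n + 2 * k) j).

Definition Ymx (n d k : nat) (u v t : R) : 'M[R]_((d - k).+1) :=
  \matrix_(i, j) (lambdaY n k i j * (normGegenbauer R (n + 2 * k) i).[u]
                  * (normGegenbauer R (n + 2 * k) j).[v] * Q (n - 1) k u v t).

Definition Smx (n d k : nat) (u v t : R) : 'M[R]_((d - k).+1) :=
  6^-1 *: (Ymx n d k u v t + Ymx n d k u t v + Ymx n d k v u t
           + Ymx n d k v t u + Ymx n d k t u v + Ymx n d k t v u).

End Matrices.

Section WellDefinedness.
Variable R : realType.
Implicit Types (n : nat) (theta : R).

Lemma packing n theta : 0 < theta <= pi ->
  exists B : nat, forall C, @spherical_code R n theta C -> C #<= `I_B.
Proof.
move=> /andP[t0 tpi].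
have c1 : cos theta < 1.
  by rewrite -cos0 ltr_cos ?in_itv/= ?lexx ?pi_ge0 ?tpi ?(ltW t0).
set e := 2 * (1 - cos theta); have e0 : 0 < e by rewrite /e; lra.
pose K := (Num.truncn (n%:R / e)).+1.
have K0 : (0 : R) < K%:R by rewrite ltr0n.
have nK : n%:R < e * K%:R.
  by rewrite mulrC -ltr_pdivrMr//; exact: truncnS_gt.
pose g (x : R) := Num.truncn ((x + 1) * K%:R).
pose T := {ffun 'I_n -> 'I_(2 * K).+1}.
pose f (x : 'rV[R]_n) : T := [ffun i => inord (g (x 0 i))].
exists #|T| => C [Csph Cdot].
have dist (x y : 'rV[R]_n) : sphere x -> sphere y ->
    \sum_i (x 0 i - y 0 i) ^+ 2 = 2 - 2 * dotp x y.
  move=> sx sy; transitivity (dotp x x + dotp y y - 2 * dotp x y).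
    by rewrite /dotp mulr_sumr -sumrN -!big_split; apply: eq_bigr => i _ /=; ring.
  by rewrite sx sy; ring.
have bnd (x : 'rV[R]_n) (i : 'I_n) : sphere x -> -1 <= x 0 i <= 1.
  move=> sx; have : x 0 i ^+ 2 <= 1.
    rewrite -[leRHS]sx /dotp (bigD1 i)//= -expr2 lerDl.
    by apply: sumr_ge0 => j _; rewrite -expr2 sqr_ge0.
  by move=> ?; apply/andP; split; nra.
have gle (x : 'rV[R]_n) (i : 'I_n) : sphere x -> (g (x ord0 i) < (2 * K).+1)%N.
  move=> sx; have /andP[a b] := bnd _ i sx.
  rewrite ltnS /g truncn_le_nat -natr1 natrM.
  have : (x ord0 i + 1) * K%:R <= 2 * K%:R by rewrite ler_pM2r//; lra.
  lra.
have finj (x y : 'rV[R]_n) : C x -> C y -> f x = f y -> x = y.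
  move=> Cx Cy fxy; apply: contrapT => xy.
  have sx := Csph _ Cx; have sy := Csph _ Cy.
  have := dist _ _ sx sy; have le1 := Cdot _ _ Cx Cy xy => Ed.
  have : \sum_i (x 0 i - y 0 i) ^+ 2 <= \sum_(i < n) (K%:R^-1 : R).
    apply: ler_sum => i _.
    have gxy : g (x 0 i) = g (y 0 i).
      move/ffunP: fxy => /(_ i); rewrite !ffunE => /(congr1 val) /=.
      by rewrite !inordK ?gle.
    have /andP[a b] := bnd _ i sx; have /andP[a' b'] := bnd _ i sy.
    have px : 0 <= (x 0 i + 1) * K%:R by rewrite mulr_ge0 ?ler0n//; lra.
    have py : 0 <= (y 0 i + 1) * K%:R by rewrite mulr_ge0 ?ler0n//; lra.
    have /andP[x1 x2] := truncn_itv px; have /andP[y1 y2] := truncn_itv py.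
    rewrite -/(g _) gxy in x1; rewrite -/(g _) gxy -natr1 in x2.
    rewrite -/(g _) in y1; rewrite -/(g _) -natr1 in y2.
    set D := x 0 i - y 0 i.
    have D1 : D * K%:R <= 1 by rewrite /D; lra.
    have D2 : -1 <= D * K%:R by rewrite /D; lra.
    have KV : K%:R^-1 * K%:R = 1 :> R by rewrite mulVf ?gt_eqF.
    have K1 : 1 <= K%:R :> R by rewrite ler1n.
    have sq : (D * K%:R) ^+ 2 <= 1 by nra.
    rewrite -(ler_pM2r K0) KV; apply: le_trans sq.
    by rewrite exprMn; apply: ler_wpM2l; [exact: sqr_ge0|rewrite expr2; nra].
  rewrite Ed sumr_const card_ord -[leRHS]mulr_natl.
  move=> /(ler_wpM2r (ltW K0)); rewrite divfK ?gt_eqF// => le2.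
  suff : e * K%:R <= n%:R by rewrite leNgt nK.
  apply: le_trans le2; rewrite ler_pM2r// /e; lra.
pose r (x : 'rV[R]_n) : nat := enum_rank (f x).
have rinj : {in C &, injective r}.
  by move=> x y /set_mem Cx /set_mem Cy /val_inj/enum_rank_inj; exact: finj.
rewrite -(card_le_eql (inj_card_eq rinj)).
by apply: subset_card_le => _ [x _ <-]; exact: ltn_ord.
Qed.

Lemma max_code_cardP n theta : 0 < theta <= pi ->
  is_max_code_card n theta (max_code_card n theta).
Proof.
move=> /(packing n)[B HB].
pose p N := `[< exists2 C, @spherical_code R n theta C & C #= `I_N >].
have p0 : exists N, p N.
  exists 0%N; apply/asboolP; exists set0; first by split.
  by rewrite II0 card_eq00.
have pB N : p N -> (N <= B)%N.
  by move=> /asboolP[C CC CN]; rewrite -card_le_II -(card_le_eql CN) HB.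
rewrite /max_code_card; apply: (@xgetPex _ 0%N [set N | is_max_code_card n theta N]).
case: (ex_maxnP p0 pB) => N /asboolP pN maxN; exists N; split=> // C CC.
have /finite_setP[m Cm] : finite_set C by apply/finite_set_leP; exists B; exact: HB.
by rewrite (card_le_eql Cm) card_le_II maxN//; apply/asboolP; exists C.
Qed.

Lemma gegenbauer_parity (l : R) k j : odd (k + j) -> (gegenbauer l k)`_j = 0.
Proof.
elim/ltn_ind: k j => -[|[|k]] IH j.
- by rewrite /= coef1; case: j.
- by rewrite /= coefZ coefX; case: j => [|[|j]]// _; rewrite mulr0.
- rewrite !addSn oddS [odd _]/= negbK => o.
  have IH1 : (if j == 0%N then 0 else (gegenbauer l k.+1)`_j.-1) = 0.
    case: j o => [|j] o //; apply: IH => //.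
    by rewrite addSnnS.
  rewrite [gegenbauer _ _]/= coefZ coefB !coefZ coefXM IH1.
  by rewrite (IH k)// !mulr0 subr0 mulr0.
Qed.

Lemma chebyshev_parity k j : odd (k + j) -> (chebyshev R k)`_j = 0.
Proof.
elim/ltn_ind: k j => -[|[|k]] IH j.
- by rewrite /= coef1; case: j.
- by rewrite /= coefX; case: j => [|[|j]].
- rewrite !addSn oddS [odd _]/= negbK => o.
  have IH1 : (if j == 0%N then 0 else (chebyshev R k.+1)`_j.-1) = 0.
    case: j o => [|j] o //; apply: IH => //.
    by rewrite addSnnS.
  rewrite [chebyshev _ _]/= coefB !coefZ coefXM IH1.
  by rewrite (IH k)// mulr0 subr0.
Qed.

Lemma size_gegenbauer (l : R) k : (size (gegenbauer l k) <= k.+1)%N.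
Proof.
elim/ltn_ind: k => -[|[|k]] IH.
- by rewrite size_poly1.
- by apply: leq_trans (size_scale_leq _ _) _; rewrite size_polyX.
- rewrite [gegenbauer _ _]/=; apply: leq_trans (size_scale_leq _ _) _.
  apply: leq_trans (size_polyD _ _) _; rewrite size_polyN geq_max; apply/andP; split.
    apply: leq_trans (size_scale_leq _ _) _.
    by apply: leq_trans (size_polyMleq _ _) _; rewrite size_polyX; exact: IH k.+1 (ltnSn _).
  by apply: leq_trans (size_scale_leq _ _) _; apply: leq_trans (IH k (leqW (ltnSn k))) _; rewrite leqW.
Qed.

Lemma size_chebyshev k : (size (chebyshev R k) <= k.+1)%N.
Proof.
elim/ltn_ind: k => -[|[|k]] IH.
- by rewrite size_poly1.
- by rewrite size_polyX.
- rewrite [chebyshev _ _]/=.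
  apply: leq_trans (size_polyD _ _) _; rewrite size_polyN geq_max; apply/andP; split.
    apply: leq_trans (size_scale_leq _ _) _.
    by apply: leq_trans (size_polyMleq _ _) _; rewrite size_polyX; exact: IH k.+1 (ltnSn _).
  by apply: leq_trans (IH k (leqW (ltnSn k))) _; rewrite leqW.
Qed.

Lemma normGegenbauer_parity m k j : odd (k + j) -> (normGegenbauer R m k)`_j = 0.
Proof.
move=> o; rewrite /normGegenbauer; case: ifP => _; first exact: chebyshev_parity.
by rewrite coefZ gegenbauer_parity// mulr0.
Qed.

Lemma size_normGegenbauer m k : (size (normGegenbauer R m k) <= k.+1)%N.
Proof.
rewrite /normGegenbauer; case: ifP => _; first exact: size_chebyshev.
exact: leq_trans (size_scale_leq _ _) (size_gegenbauer _ _).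
Qed.

Lemma QE m k (u v t : R) : 0 < (1 - u ^+ 2) * (1 - v ^+ 2) ->
  Q m k u v t =
  ((1 - u ^+ 2) * (1 - v ^+ 2)) `^ (k%:R / 2) *
  (normGegenbauer R m k).[(t - u * v) / Num.sqrt ((1 - u ^+ 2) * (1 - v ^+ 2))].
Proof.
rewrite /Q; set w := _ * (1 - v ^+ 2) => w0.
have -> : w `^ (k%:R / 2) = Num.sqrt w ^+ k.
  by rewrite mulrC powRrM powR12_sqrt ?ltW// powR_mulrn// sqrtr_ge0.
have s0 : Num.sqrt w != 0 by rewrite gt_eqF// sqrtr_gt0.
have sq : Num.sqrt w ^+ 2 = w by rewrite sqr_sqrtr// ltW.
rewrite (horner_coef_wide _ (size_normGegenbauer m k)) mulr_sumr.
apply: eq_bigr => -[j] /=; rewrite ltnS => jk _.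
have [ij|ij] := boolP (odd (k + j)).
  by rewrite normGegenbauer_parity// !mul0r mulr0.
have ekj : (k - j)./2.*2 = (k - j)%N.
  by apply: even_halfK; rewrite oddB// -oddD.
rewrite -[X in X ^+ (k - j)./2]sq -exprM mul2n ekj expr_div_n.
have -> : Num.sqrt w ^+ k = Num.sqrt w ^+ (k - j) * Num.sqrt w ^+ j.
  by rewrite -exprD subnK.
field.
by rewrite expf_neq0.
Qed.

End WellDefinedness.

(* Main.v *)
(** A kernel such as [P_k^m(x.y)] is positive definite because its homogenisation
    [K_y(x) = |x|^k |y|^k P_k^m(x.y / |x||y|)] is a harmonic polynomial in [x]
    (Gegenbauer's differential equation) that differs from a positive multiple of
    [(x.y)^k] by a multiple of [|x|^2].  For the Fischer product
    [<p, q> = p(d/dx) q], multiplication by [|x|^2] is adjoint to the Laplacian and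
    [(x.y)^k] reproduces values, so [K_y(x)] is a positive multiple of
    [<K_x, K_y>].  Applied in the orthogonal complement of a code point [e], this
    shows that summing [Y_k^n(e.c, e.c', c.c')] over [c, c'] in the code pairs
    nonnegatively with [F_k].  Summing (iv) over ordered pairs and (v) over ordered
    triples of distinct code points then gives the bound, once
    [b11 + 2 b12 (N-1) + b22 (N-1)^2 >= 0] is used, [N] being the size of the code. *)

Require Import Defs.
From mathcomp Require Import all_boot all_order all_algebra.
From mathcomp Require Import all_classical all_reals all_analysis.
From mathcomp Require Import zify ring lra.
From mathcomp Require mpoly.
Import -(notations) mpoly.

Set Implicit Arguments.
Unset Strict Implicit.
Unset Printing Implicit Defensive.

Import Order.TTheory GRing.Theory Num.Theory.
Local Open Scope ring_scope.

(** * Fischer product *)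

Section Fischer.
Variables (R : realType) (m : nat).
Local Notation polys := (mpoly m R).
Implicit Types (p q r : polys) (x y : 'rV[R]_m).

(* [(1/k!) sum_{i1..ik} (d_i1 ... d_ik p)(0) (d_i1 ... d_ik q)(0)], which on
   homogeneous polynomials of degree [k] is the Fischer product [p(d/dx) q].  In
   this form positivity is immediate, and the adjunction [fischer_mvar] follows
   from [[d_j, x_i] = delta_ij] by induction. *)
Fixpoint fischer k p q : R :=
  if k is k'.+1
  then k%:R^-1 * \sum_i fischer k' (mderiv i p) (mderiv i q)
  else meval (fun=> 0) p * meval (fun=> 0) q.

Lemma fischerC k p q : fischer k p q = fischer k q p.
Proof.
elim: k p q => [|k IH] p q /=; first by rewrite mulrC.
by congr (_ * _); apply: eq_bigr => i _.
Qed.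

Lemma fischerDl k p q r : fischer k (p + q) r = fischer k p r + fischer k q r.
Proof.
elim: k p q r => [|k IH] p q r /=; first by rewrite mevalD mulrDl.
rewrite -mulrDr -big_split; congr (_ * _).
by apply: eq_bigr => i _ /=; rewrite mderivD IH.
Qed.

Lemma fischerZl k c p q : fischer k (c *: p) q = c * fischer k p q.
Proof.
elim: k p q => [|k IH] p q /=; first by rewrite mevalZ mulrA.
rewrite mulrCA [in RHS]mulr_sumr; congr (_ * _).
by apply: eq_bigr => i _; rewrite mderivZ IH.
Qed.

Lemma fischerZr k c p q : fischer k p (c *: q) = c * fischer k p q.
Proof. by rewrite fischerC fischerZl fischerC. Qed.

Lemma fischer0l k q : fischer k 0 q = 0.
Proof. by rewrite -[0](scale0r (0 : polys)) fischerZl mul0r. Qed.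

Lemma fischer0r k q : fischer k q 0 = 0.
Proof. by rewrite fischerC fischer0l. Qed.

Lemma fischer_suml k (I : Type) (s : seq I) (P : pred I) (f : I -> polys) q :
  fischer k (\sum_(i <- s | P i) f i) q = \sum_(i <- s | P i) fischer k (f i) q.
Proof.
by apply: (big_rec2 (fun u v => fischer k u q = v)) => [|i u v _ <-];
  rewrite ?fischer0l ?fischerDl.
Qed.

Lemma fischer_sumr k (I : Type) (s : seq I) (P : pred I) (f : I -> polys) q :
  fischer k q (\sum_(i <- s | P i) f i) = \sum_(i <- s | P i) fischer k q (f i).
Proof.
by rewrite fischerC fischer_suml; apply: eq_bigr => i _; rewrite fischerC.
Qed.

(** Induction on [k]: for [k = 0] this is the quadratic form of [F] at the vector of values at the
    origin, and each step gives a positive multiple of a sum of the same forms for the partial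
    derivatives of [w]. *)
Lemma fischer_psd k s (F : 'M[R]_s) (w : 'I_s -> polys) :
  psdmx F -> 0 <= \sum_i \sum_j F i j * fischer k (w i) (w j).
Proof.
move=> [_ Fpos]; elim: k w => [|k IH] w /=.
  have := Fpos (\row_i meval (fun=> 0) (w i)).
  rewrite mxE => F0; apply: le_trans F0 _; rewrite le_eqVlt; apply/orP; left.
  apply/eqP; rewrite [in RHS]exchange_big; apply: eq_bigr => j _; rewrite !mxE mulr_suml.
  by apply: eq_bigr => i _; rewrite !mxE; ring.
rewrite [leRHS](_ : _ = k.+1%:R^-1 * \sum_l \sum_i \sum_j
   F i j * fischer k (mderiv l (w i)) (mderiv l (w j))); last first.
  rewrite [in RHS]exchange_big mulr_sumr; apply: eq_bigr => i _.
  rewrite [in RHS]exchange_big mulr_sumr; apply: eq_bigr => j _ /=.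
  by rewrite -mulr_sumr mulrCA.
by rewrite mulr_ge0 ?invr_ge0//; apply: sumr_ge0 => l _; exact: IH.
Qed.

Definition mvar i : polys := mpolyX R (mnm1 i).

Lemma mderiv_mvar i j : mderiv j (mvar i) = (i == j)%:R.
Proof.
rewrite /mvar mderivX mnm1E; case: eqP => [->|_]; last by rewrite scale0r.
rewrite scale1r (_ : mnm_sub _ _ = mnm0) ?mpolyX0//.
by apply/mnmP => l; rewrite mnmBE subnn mnm0E.
Qed.

Lemma fischerS k p q :
  fischer k.+1 p q = k.+1%:R^-1 * \sum_i fischer k (mderiv i p) (mderiv i q).
Proof. by []. Qed.

Lemma fischer_mvar k i p q :
  fischer k.+1 (mvar i * p) q = fischer k p (mderiv i q).
Proof.
have split_sum k' (p' q' : polys) :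
    \sum_j fischer k' (mderiv j (mvar i * p')) (mderiv j q') =
    fischer k' p' (mderiv i q') +
    \sum_j fischer k' (mvar i * mderiv j p') (mderiv j q').
  under eq_bigr do rewrite mderivM mderiv_mvar fischerDl.
  rewrite big_split /=; congr (_ + _).
  rewrite (bigD1 i)//= eqxx mul1r big1 ?addr0// => j /negPf ji.
  by rewrite eq_sym ji mul0r fischer0l.
elim: k p q => [|k IH] p q.
  rewrite fischerS invr1 mul1r split_sum big1 ?addr0// => j _.
  by rewrite /= mevalM mevalXU !mul0r.
rewrite fischerS split_sum.
(* The commutators contribute one copy of the right-hand side and the induction hypothesis [k.+1]
   copies, which together cancel [k.+2%:R^-1]. *)
rewrite [X in _ + X](_ : _ = k.+1%:R * fischer k.+1 p (mderiv i q)); last first.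
  rewrite fischerS mulrA mulfV ?pnatr_eq0// mul1r.
  by apply: eq_bigr => j _; rewrite IH mderiv_comm.
rewrite -[X in X + _]mul1r -mulrDl mulrA (_ : 1 + _ = k.+2%:R) ?natrD -?nat1r//.
by rewrite mulVf ?mul1r// pnatr_eq0.
Qed.

Definition lin x : polys := \sum_i x 0 i *: mvar i.
Definition nrm2 : polys := \sum_i mvar i ^+ 2.
Definition lap p : polys := \sum_i mderiv i (mderiv i p).

Lemma lapD p q : lap (p + q) = lap p + lap q.
Proof. by rewrite /lap -big_split; apply: eq_bigr => i _; rewrite !mderivD. Qed.

Lemma lapZ c p : lap (c *: p) = c *: lap p.
Proof. by rewrite /lap scaler_sumr; apply: eq_bigr => i _; rewrite !mderivZ. Qed.

Lemma lap_sum (I : Type) (s : seq I) (P : pred I) (f : I -> polys) :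
  lap (\sum_(i <- s | P i) f i) = \sum_(i <- s | P i) lap (f i).
Proof.
apply: (big_rec2 (fun u v => lap u = v)) => [|i u v _ <-]; last by rewrite lapD.
by rewrite -[0](scale0r (0 : polys)) lapZ !scale0r.
Qed.

Lemma fischer_nrm2 k p q : fischer k.+2 (nrm2 * p) q = fischer k p (lap q).
Proof.
rewrite mulr_suml fischer_suml fischer_sumr; apply: eq_bigr => i _.
by rewrite expr2 -mulrA !fischer_mvar.
Qed.

Lemma mderiv_exp i p k :
  mderiv i (p ^+ k) = k%:R *: (p ^+ k.-1 * mderiv i p).
Proof.
elim: k => [|k IH]; first by rewrite expr0 scale0r -mpolyC1 mderivC.
rewrite exprS mderivM IH /= -scalerAr mulrA -[k.+1]add1n natrD scalerDl scale1r.
rewrite (mulrC (mderiv i p)); congr (_ + _).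
by case: k {IH} => [|k]; rewrite ?scale0r// -exprS.
Qed.

Lemma mderiv_lin i y : mderiv i (lin y) = y 0 i *: 1.
Proof.
rewrite raddf_sum (bigD1 i)//= mderivZ mderiv_mvar eqxx big1 ?addr0// => j /negPf ji.
by rewrite mderivZ mderiv_mvar ji scaler0.
Qed.

Lemma mderiv_nrm2 i : mderiv i nrm2 = 2 *: mvar i.
Proof.
rewrite raddf_sum (bigD1 i)//= mderiv_exp mderiv_mvar eqxx mulr1 expr1.
rewrite big1 ?addr0// => j /negPf ji.
by rewrite mderiv_exp mderiv_mvar ji mulr0 scaler0.
Qed.

Lemma mderiv_lin_exp i y j :
  mderiv i (lin y ^+ j) = (j%:R * y 0 i) *: lin y ^+ j.-1.
Proof. by rewrite mderiv_exp mderiv_lin -scalerAr mulr1 scalerA. Qed.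

Lemma mderiv_nrm2_exp i h :
  mderiv i (nrm2 ^+ h) = (2 * h%:R) *: (mvar i * nrm2 ^+ h.-1).
Proof. by rewrite mderiv_exp mderiv_nrm2 -scalerAr scalerA [_ * mvar i]mulrC [2 * _]mulrC. Qed.

(** The scalar kills the case [k = 0], where the truncated predecessor would make the powers
    differ. *)
Lemma scale_exp p k : k%:R *: (p * p ^+ k.-1) = k%:R *: p ^+ k.
Proof. by case: k => [|k]; rewrite ?scale0r//= exprS. Qed.

(** Product rule; summing over [i] turns the squares of the variables into [nrm2] and the cross
    terms into [lin y]. Wherever a predecessor is truncated, its scalar vanishes. *)
Lemma lap_nrm2_lin h j y :
  lap (nrm2 ^+ h * lin y ^+ j) =
  (2 * h%:R * (2 * h%:R + 2 * j%:R + m%:R - 2)) *: (nrm2 ^+ h.-1 * lin y ^+ j)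
  + (j%:R * j.-1%:R * dotp y y) *: (nrm2 ^+ h * lin y ^+ j.-2).
Proof.
have E i : mderiv i (mderiv i (nrm2 ^+ h * lin y ^+ j)) =
    (2 * h%:R) *: (nrm2 ^+ h.-1 * lin y ^+ j)
  + (2 * h%:R) *: ((2 * h.-1%:R) *: (mvar i ^+ 2 * nrm2 ^+ h.-2 * lin y ^+ j))
  + (2 * h%:R) *: ((2 * j%:R) *: ((y 0 i *: mvar i) *
      (nrm2 ^+ h.-1 * lin y ^+ j.-1)))
  + (y 0 i * y 0 i) *: ((j%:R * j.-1%:R) *: (nrm2 ^+ h * lin y ^+ j.-2)).
  rewrite mderivM mderiv_nrm2_exp mderiv_lin_exp -scalerAl -scalerAr mderivD !mderivZ.
  rewrite !mderivM mderiv_mvar eqxx !mderiv_nrm2_exp !mderiv_lin_exp.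
  rewrite -!scalerAl -!scalerAr -!mul_mpolyC !mpolyCM.
  move: (nrm2 ^+ h) (nrm2 ^+ h.-1) (nrm2 ^+ h.-2) (lin y ^+ j) => N0 N1 N2 L0.
  move: (lin y ^+ j.-1) (lin y ^+ j.-2) => L1 L2.
  by rewrite /=; ring.
rewrite /lap (eq_bigr _ (fun i _ => E i)) !big_split /= -!scaler_sumr -scaler_suml.
rewrite sumr_const card_ord -!mulr_suml -/nrm2 -/(lin y) -/(dotp y y).
have -> : (2 * h.-1%:R) *: (nrm2 * nrm2 ^+ h.-2 * lin y ^+ j) =
          (2 * h.-1%:R) *: (nrm2 ^+ h.-1 * lin y ^+ j).
  by rewrite -!scalerA; congr (_ *: _); rewrite scalerAl scale_exp -scalerAl.
have -> : (2 * j%:R) *: (lin y * (nrm2 ^+ h.-1 * lin y ^+ j.-1)) =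
          (2 * j%:R) *: (nrm2 ^+ h.-1 * lin y ^+ j).
  by rewrite mulrCA -!scalerA; congr (_ *: _); rewrite scalerAr scale_exp -scalerAr.
rewrite !scalerA -[_ *+ m]scaler_nat scalerA -!scalerDl mulrC; congr (_ *: _ + _ *: _); last by ring.
by case: h {E} => [|h]; rewrite ?mulr0n //= -?natr1; ring.
Qed.

Lemma lap_lin_exp k x :
  lap (lin x ^+ k.+2) = (k.+2%:R * k.+1%:R * dotp x x) *: lin x ^+ k.
Proof.
by have := lap_nrm2_lin 0 k.+2 x; rewrite !expr0 !mul1r mulr0 mul0r scale0r add0r.
Qed.

(** Pairing with the [k]-th power of [lin x] evaluates a form of degree [k] at [x], up to the factor
    [k!]. The powers of [nrm2] are moved across as Laplacians, then the factors [lin y] as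
    derivatives. *)
Lemma fischer_lin_exp h j x y :
  fischer (h.*2 + j) (lin x ^+ (h.*2 + j)) (nrm2 ^+ h * lin y ^+ j) =
  (h.*2 + j)`!%:R * dotp x x ^+ h * dotp x y ^+ j.
Proof.
elim: h => [|h IH]; last first.
  rewrite doubleS !addSn fischerC exprS -mulrA fischer_nrm2 lap_lin_exp fischerZr.
  by rewrite fischerC IH !factS !natrM [in RHS]exprS; ring.
rewrite double0 !expr0 mul1r mulr1 add0n.
elim: j => [|j IH]; first by rewrite !expr0 /= -mpolyC1 mevalC !mulr1.
rewrite [lin y ^+ _]exprS mulr_suml fischer_sumr.
under eq_bigr => i _.
  rewrite -scalerAl fischerZr fischerC fischer_mvar mderiv_lin_exp fischerZr.
  rewrite fischerC IH; over.
rewrite factS natrM exprS [in RHS]/dotp !(mulr_suml, mulr_sumr).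
by apply: eq_bigr => i _ /=; rewrite -/(dotp x y); ring.
Qed.

End Fischer.

(** * Gegenbauer polynomials *)

Section Gegenbauer.
Variables (R : realType) (l : R).
Local Notation C := (gegenbauer l).
Local Notation L := (l%:P).

Lemma gegenbauer_def k : C k.+2 =
  k.+2%:R^-1 *: ((2 * (k.+2%:R + l - 1)) *: ('X * C k.+1)
                 - (k.+2%:R + 2 * l - 2) *: C k).
Proof. by []. Qed.

(** Clears the denominator for arbitrary [p] and [q], so as to serve both the recurrence and its
    derivative. *)
Lemma gegenbauer_recE k (p q : {poly R}) :
  k.+2%:R * (k.+2%:R^-1 *: ((2 * (k.+2%:R + l - 1)) *: p - (k.+2%:R + 2 * l - 2) *: q))
  = 2 * (k%:R + 1 + L) * p - (k%:R + 2 * L) * q.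
Proof.
rewrite -[k.+2%:R in LHS]polyC_natr mul_polyC scalerA.
rewrite mulfV ?pnatr_eq0// scale1r -!mul_polyC.
have -> : (2 * (k.+2%:R + l - 1))%:P = 2 * (k%:R + 1 + L) :> {poly R}.
  by rewrite (_ : 2 * _ = 2%:R * (k%:R + 1%:R + l)) ?polyCM ?polyCD ?polyC_natr//
    -!natr1; ring.
have -> // : (k.+2%:R + 2 * l - 2)%:P = k%:R + 2 * L :> {poly R}.
by rewrite (_ : _ - 2 = k%:R + 2%:R * l) ?polyCD ?polyCM ?polyC_natr//
  -!natr1; ring.
Qed.

Lemma gegenbauerSS k :
  k.+2%:R * C k.+2 = 2 * (k%:R + 1 + L) * ('X * C k.+1) - (k%:R + 2 * L) * C k.
Proof. by rewrite gegenbauer_def gegenbauer_recE. Qed.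

Lemma gegenbauer_derivSS k :
  k.+2%:R * (C k.+2)^`() =
  2 * (k%:R + 1 + L) * (C k.+1 + 'X * (C k.+1)^`()) - (k%:R + 2 * L) * (C k)^`().
Proof.
by rewrite gegenbauer_def derivZ derivB !derivZ derivM derivX mul1r gegenbauer_recE.
Qed.

(* Each of the two identities needs the other one at the previous index. *)
Lemma gegenbauer_derivS k :
  'X * (C k.+1)^`() - (C k)^`() = k.+1%:R * C k.+1 /\
  (C k.+1)^`() - 'X * (C k)^`() = (k%:R + 2 * L) * C k.
Proof.
elim: k => [|k [a1 b0]].
  have d1 : (1 : {poly R})^`() = 0 by rewrite -polyC1 derivC.
  rewrite /= derivZ derivX d1 -!mul_polyC polyCM polyC_natr.
  by split; ring.
have E := gegenbauerSS k; have dE := gegenbauer_derivSS k.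
have Ck' : (C k)^`() = 'X * (C k.+1)^`() - k.+1%:R * C k.+1.
  by rewrite -a1; ring.
have n0 : k.+2%:R != 0 :> {poly R} by rewrite -polyC_natr polyC_eq0 pnatr_eq0.
(* The differentiated recurrence, with the derivative of [C k] eliminated through [a1]. *)
have b1 : (C k.+2)^`() - 'X * (C k.+1)^`() = (k.+1%:R + 2 * L) * C k.+1.
  apply: (mulfI n0).
  by rewrite mulrBr dE Ck' -!natr1; ring.
split=> //.
have Ck2' : (C k.+2)^`() = 'X * (C k.+1)^`() + (k.+1%:R + 2 * L) * C k.+1.
  by rewrite -b1; ring.
rewrite E Ck2'.
have -> : (k%:R + 2 * L) * C k = (C k.+1)^`() - 'X * ('X * (C k.+1)^`() - k.+1%:R * C k.+1).
  by rewrite -Ck' b0.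
by rewrite -!natr1; ring.
Qed.

(** The two first-order identities express [(1 - X^2) C_k'] through [C_k] and [C_(k+1)];
    differentiating this and eliminating [C_(k+1)'] gives the equation. *)
Lemma gegenbauer_ode k :
  (1 - 'X ^+ 2) * (C k)^`()^`() - (2 * L + 1) * 'X * (C k)^`()
  + k%:R * (k%:R + 2 * L) * C k = 0.
Proof.
have [a1 b0] := gegenbauer_derivS k.
have Ck1' : (C k.+1)^`() = 'X * (C k)^`() + (k%:R + 2 * L) * C k.
  by rewrite -b0; ring.
have kE : (k%:R + 2 * l)%:P = k%:R + 2 * L :> {poly R}.
  by rewrite polyCD polyCM !polyC_natr.
have c : (1%:P - 'X * 'X) * (C k)^`()
       = (k%:R + 2 * l) *: ('X * C k) - k.+1%:R *: C k.+1.
  rewrite -!mul_polyC kE polyC_natr -a1 Ck1' polyC1; ring.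
have := congr1 (@deriv R) c.
rewrite derivM !derivB derivC derivM derivX !derivZ derivM derivX.
rewrite -!mul_polyC kE polyC_natr Ck1' polyC1.
move=> /eqP; rewrite -subr_eq0 => /eqP e; rewrite -[RHS]e.
by rewrite -!natr1; ring.
Qed.

Lemma gegenbauer_coefSS k i :
  (C k)`_i.+2 * (i.+2%:R * i.+1%:R)
  = - (C k)`_i * (k%:R - i%:R) * (k%:R + i%:R + 2 * l).
Proof.
have kE : (k%:R + 2 * l)%:P = k%:R + 2 * L :> {poly R}.
  by rewrite polyCD polyCM !polyC_natr.
have lE : (2 * l + 1)%:P = 2 * L + 1 :> {poly R}.
  by rewrite polyCD polyCM polyC_natr.
(* The equation is rewritten with single factors ['X] and scalars, so that coefficients can be read
   off directly. *)
have ode : (C k)^`()^`() - 'X * ('X * (C k)^`()^`()) - (2 * l + 1) *: ('X * (C k)^`())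
    + k%:R *: ((k%:R + 2 * l) *: C k) = 0.
  rewrite -(gegenbauer_ode k) -!mul_polyC kE lE polyC_natr; ring.
have := congr1 (fun p : {poly R} => p`_i) ode.
rewrite coef0 !(coefD, coefN, coefZ, coefXM) !coef_deriv.
move=> e; apply/eqP; rewrite -subr_eq0; apply/eqP; rewrite -[RHS]e.
case: i {e} => [|[|i]] /=; move: (C k) => c; rewrite -!natr1; ring.
Qed.

Hypothesis l_gt0 : 0 < l.

Lemma gegenbauer_lead_gt0 k : 0 < (C k)`_k.
Proof.
elim/ltn_ind: k => -[|[|k]] IH; first by rewrite coef1.
  by rewrite /= coefZ coefX mulr1 mulr_gt0.
rewrite gegenbauer_def coefZ coefB !coefZ coefXM /= (nth_default 0 (leqW (size_gegenbauer l k))).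
rewrite mulr0 subr0 mulr_gt0 ?invr_gt0 ?ltr0n// mulr_gt0//; last exact: IH k.+1 (ltnSn _).
have -> : k.+2%:R = k%:R + 2 :> R by rewrite -natrD addn2.
move: (k%:R) (ler0n R k) l_gt0 => x x0 l0.
by rewrite mulr_gt0 //; lra.
Qed.

(** At 1 the left-hand sides of the two identities of [gegenbauer_derivS] coincide. *)
Lemma gegenbauer_horner1 k : k.+1%:R * (C k.+1).[1] = (k%:R + 2 * l) * (C k).[1].
Proof.
have [_ b0] := gegenbauer_derivS k; have [a1 _] := gegenbauer_derivS k.
have := congr1 (horner^~ 1) a1; have := congr1 (horner^~ 1) b0.
rewrite !(hornerD, hornerN, hornerM, hornerX, hornerC) -!polyC_natr !hornerC.
rewrite !mul1r; move=> -> <-; ring.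
Qed.

Lemma gegenbauer_horner1_gt0 k : 0 < (C k).[1].
Proof.
elim: k => [|k IH]; first by rewrite hornerC.
rewrite -(pmulr_rgt0 _ (ltr0Sn R k)) gegenbauer_horner1 mulr_gt0//.
by rewrite ltr_wpDl// mulr_gt0.
Qed.

End Gegenbauer.

(** * Zonal kernels *)

Section ZonalKernels.
Variable R : realType.

(* [r^(k/2) P(s / sqrt r)] for [P] of degree [k] and of the parity of [k]. *)
Definition homog_eval (P : {poly R}) k (s r : R) : R :=
  \sum_(j < k.+1) P`_j * s ^+ j * r ^+ (k - j)./2.

(* [|x|^k |y|^k P (x.y / |x||y|)] as a polynomial in [x]. *)
Definition zonal m (P : {poly R}) k (y : 'rV[R]_m) : mpoly m R :=
  \sum_(j < k.+1) (P`_j * dotp y y ^+ (k - j)./2)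
                  *: (nrm2 R m ^+ (k - j)./2 * lin y ^+ j).

Section Reproducing.
Variables (m : nat) (P : {poly R}) (k : nat).
Hypothesis parP : forall j, odd (k + j) -> P`_j = 0.

Let evenP j : (j <= k)%N -> ~~ odd (k + j) -> (k - j)./2.*2 = (k - j)%N.
Proof. by move=> jk o; apply: even_halfK; rewrite oddB// -oddD. Qed.

(** The hypothesis is the coefficient form of Gegenbauer's equation with parameter [m/2 - 1]. The
    Laplacian of the [j]-th term has two parts, [T1 j] and [T2 j]; [T1 j] and [T2 j.+2] are
    multiples of the same polynomial and cancel. *)
Lemma lap_zonal y :
  (forall j, P`_j.+2 * (j.+2%:R * j.+1%:R)
     = - P`_j * (k%:R - j%:R) * (k%:R + j%:R + m%:R - 2)) ->
  lap (zonal P k y) = 0 :> mpoly m R.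
Proof.
move=> odeP; rewrite /zonal lap_sum.
pose h j := (k - j)./2.
pose T1 j := (P`_j * dotp y y ^+ h j
  * (2 * (h j)%:R * (2 * (h j)%:R + 2 * j%:R + m%:R - 2)))
  *: (nrm2 R m ^+ (h j).-1 * lin y ^+ j).
pose T2 j := (P`_j * dotp y y ^+ h j * (j%:R * j.-1%:R * dotp y y))
  *: (nrm2 R m ^+ h j * lin y ^+ j.-2).
transitivity (\sum_(j < k.+1) T1 j + \sum_(j < k.+1) T2 j).
  rewrite -big_split; apply: eq_bigr => j _.
  by rewrite lapZ lap_nrm2_lin scalerDr !scalerA.
have T10 j : (k - j <= 1)%N -> T1 j = 0.
  rewrite /T1 /h; case: (k - j)%N => [|[|//]] _;
  by rewrite mulr0 mul0r mulr0 scale0r.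
have T20 j : (j <= 1)%N -> T2 j = 0.
  by rewrite /T2; case: j => [|[|//]] _; rewrite ?mul0r ?mulr0 ?mul0r ?mulr0 scale0r.
case Ek : k => [|[|k']].
- by rewrite !big_ord_recl !big_ord0 T10 ?T20 ?Ek// !addr0.
- by rewrite !big_ord_recl !big_ord0 !T10 ?T20 ?Ek// !addr0.
(* Drop the two last terms of the first sum and the two first of the second, so that the index shift
   by two aligns them. *)
rewrite big_ord_recr big_ord_recr /= !T10 ?Ek ?subnn ?subSnn// !addr0.
rewrite [X in _ + X]big_ord_recl [X in _ + (_ + X)]big_ord_recl !T20// !add0r.
rewrite -big_split big1// => -[j /=]; rewrite ltnS => jk _; rewrite /bump !add1n.
have [od|ev] := boolP (odd (k + j)).
  rewrite /T1 /T2 (parP od) (@parP j.+2); last by rewrite !addnS /= negbK.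
  by rewrite !mul0r !scale0r addr0.
have jk2 : (j <= k)%N by rewrite Ek; lia.
have h_S : h j = (h j.+2).+1 by rewrite /h Ek !subSS (_ : k'.+2 - j = (k' - j).+2)%N //; lia.
have h_2 : 2 * (h j)%:R = k%:R - j%:R :> R.
  by rewrite -natrM mul2n (evenP jk2 ev) natrB.
rewrite /T1 /T2 h_S /= -h_S -scalerDl h_2.
apply/eqP; rewrite scaler_eq0; apply/orP; left; apply/eqP.
rewrite h_S exprS.
have -> : P`_j.+2 * dotp y y ^+ h j.+2 * (j.+2%:R * j.+1%:R * dotp y y) =
   P`_j.+2 * (j.+2%:R * j.+1%:R) * dotp y y ^+ h j.+2 * dotp y y by ring.
by rewrite odeP; ring.
Qed.

(** Every term of [zonal P k x] below the top one either vanishes by parity or contains [nrm2],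
    whose adjoint kills the harmonic [zonal P k y]. The top term, a multiple of the [k]-th power of
    [lin x], evaluates it at [x]. *)
Lemma fischer_zonal x y : lap (zonal P k y) = 0 :> mpoly m R ->
  fischer k (zonal P k x) (zonal P k y) =
  P`_k * k`!%:R * homog_eval P k (dotp x y) (dotp x x * dotp y y).
Proof.
move=> lap0; rewrite {1}/zonal big_ord_recr fischerDl subnn !expr0 mul1r mulr1.
rewrite fischer_suml big1 ?add0r => [|[j /= jk] _]; last first.
  have [od|ev] := boolP (odd (k + j)); first by rewrite parP// mul0r scale0r fischer0l.
  have := evenP (ltnW jk) ev; case: (_./2) => [|h]; first by lia.
  rewrite doubleS => kh; have -> : k = (k - 2).+2 by lia.
  rewrite fischerZl [nrm2 _ _ ^+ _]exprS -mulrA fischer_nrm2.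
  by rewrite (_ : (k - 2).+2 = k) ?lap0 ?fischer0r ?mulr0//; lia.
rewrite fischerZl -mulrA; congr (_ * _); rewrite /zonal fischer_sumr mulr_sumr.
apply: eq_bigr => -[j /=]; rewrite ltnS => jk _.
have [od|ev] := boolP (odd (k + j)); first by rewrite parP// !mul0r scale0r fischer0r mulr0.
have := evenP jk ev; set h := _./2 => kh; rewrite fischerZr.
have {1 2 3}-> : k = (h.*2 + j)%N by lia.
rewrite fischer_lin_exp exprMn (_ : (h.*2 + j)%N = k); last by lia.
ring.
Qed.

End Reproducing.

(* [K] is a positive definite kernel; the matrix [F] avoids having to
   diagonalise it when [K] is combined with a positive semidefinite matrix. *)
Definition psd_kernel T (K : T -> T -> R) := forall (I : finType) s
    (F : 'M[R]_s) (z : 'I_s -> I -> R) (pt : I -> T), psdmx F ->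
  0 <= \sum_i \sum_j F i j * \sum_c \sum_c' z i c * z j c' * K (pt c) (pt c').

Lemma psd_kernel_fischer T m k (f : T -> mpoly m R) (K : T -> T -> R) c :
  0 < c -> (forall x y, fischer k (f x) (f y) = c * K x y) -> psd_kernel K.
Proof.
move=> c0 fK I s F z pt Fpsd.
rewrite -(pmulr_rge0 _ c0).
have := fischer_psd k (fun i => \sum_e z i e *: f (pt e)) Fpsd.
congr (0 <= _); rewrite mulr_sumr; apply: eq_bigr => i _.
rewrite mulr_sumr; apply: eq_bigr => j _.
rewrite mulrCA; congr (_ * _); rewrite fischer_suml mulr_sumr; apply: eq_bigr => e _.
rewrite fischerZl fischer_sumr !mulr_sumr; apply: eq_bigr => e' _.
by rewrite fischerZr fK; ring.
Qed.

Lemma psd_kernel_rank1 T (g : T -> R) : psd_kernel (fun x y => g x * g y).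
Proof.
move=> I s F z pt [_ Fpos].
have := Fpos (\row_i \sum_e z i e * g (pt e)).
congr (0 <= _); rewrite mxE exchange_big; apply: eq_bigr => j _.
rewrite !mxE mulr_suml; apply: eq_bigr => i _; rewrite !mxE mulrAC mulrC.
congr (_ * _); rewrite big_distrlr; apply: eq_bigr => e _.
by apply: eq_bigr => e' _ /=; ring.
Qed.

Lemma psd_kernelD T (K K' : T -> T -> R) :
  psd_kernel K -> psd_kernel K' -> psd_kernel (fun x y => K x y + K' x y).
Proof.
move=> K0 K0' I s F z pt Fpsd.
have := addr_ge0 (K0 I s F z pt Fpsd) (K0' I s F z pt Fpsd).
congr (0 <= _); rewrite -big_split; apply: eq_bigr => i _.
rewrite -big_split; apply: eq_bigr => j _ /=; rewrite -mulrDr -big_split.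
congr (_ * _); apply: eq_bigr => e _; rewrite -big_split.
by apply: eq_bigr => e' _ /=; ring.
Qed.

Lemma homog_eval_chebyshevSS k (s r : R) :
  homog_eval (Defs.chebyshev R k.+2) k.+2 s r =
  2 * s * homog_eval (Defs.chebyshev R k.+1) k.+1 s r - r * homog_eval (Defs.chebyshev R k) k s r.
Proof.
rewrite /homog_eval [Defs.chebyshev R k.+2]/= -/(Defs.chebyshev R k.+1).
under eq_bigr do rewrite coefB coefZ coefXM !mulrBl.
rewrite sumrB; congr (_ - _).
  rewrite big_ord_recl /= mulr0 !mul0r add0r mulr_sumr; apply: eq_bigr => j _.
  by rewrite /bump !add1n /= subSS exprS; ring.
rewrite big_ord_recr big_ord_recr /= !(nth_default 0 (size_chebyshev _ _)) ?leqW//.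
rewrite (nth_default 0 (leqW (size_chebyshev R k))) !mul0r !addr0 mulr_sumr.
apply: eq_bigr => -[j /=]; rewrite ltnS => jk _.
by rewrite -addn2 -addnBAC// addn2 /= exprS; ring.
Qed.

(* [cexp2 x k] is [(Re z ^ k, Im z ^ k)] for [z = x_0 + i x_1]. *)
Fixpoint cexp2 (x : 'rV[R]_2) k : R * R :=
  if k is k'.+1
  then let w := cexp2 x k' in
    (x 0 0 * w.1 - x 0 1 * w.2, x 0 0 * w.2 + x 0 1 * w.1)
  else (1, 0).

(** Homogeneous form of [T_k(cos phi) = cos(k phi)]: for complex [z], [w] the right-hand side is the
    real part of [z^k] times the conjugate of [w^k], and obeys the Chebyshev recurrence. *)
Lemma homog_eval_chebyshev k (x y : 'rV[R]_2) :
  homog_eval (Defs.chebyshev R k) k (dotp x y) (dotp x x * dotp y y) =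
  (cexp2 x k).1 * (cexp2 y k).1 + (cexp2 x k).2 * (cexp2 y k).2.
Proof.
have D (u v : 'rV[R]_2) : dotp u v = u 0 0 * v 0 0 + u 0 1 * v 0 1.
  by rewrite /dotp !big_ord_recl big_ord0 addr0; congr (_ + u 0 _ * v 0 _); apply: val_inj.
elim/ltn_ind: k => -[|[|k]] IH.
- by rewrite /homog_eval big_ord1 /= coef1 !mulr1 mulr0 addr0.
- by rewrite /homog_eval !big_ord_recl big_ord0 /= !coefX D /=; ring.
- by rewrite homog_eval_chebyshevSS !IH// !D /=; ring.
Qed.

Lemma psd_kernel_zonal m k : (2 <= m)%N ->
  psd_kernel (fun x y : 'rV[R]_m =>
    homog_eval (normGegenbauer R m k) k (dotp x y) (dotp x x * dotp y y)).
Proof.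
(* In the plane the Gegenbauer parameter [m/2 - 1] is 0, and the Chebyshev kernel is instead a sum
   of two rank-one kernels. *)
move=> m2; have [e|ne] := eqVneq m 2%N.
  subst m; rewrite /normGegenbauer eqxx => I s F z pt Fpsd.
  under eq_bigr => i _. under eq_bigr => j _. under eq_bigr => c _.
    under eq_bigr do rewrite homog_eval_chebyshev.
    over. over. over.
  exact: (psd_kernelD (@psd_kernel_rank1 _ (fun x => (cexp2 x k).1))
                      (@psd_kernel_rank1 _ (fun x => (cexp2 x k).2))).
have l0 : (0 : R) < m%:R / 2 - 1.
  have : (3 <= m)%N by rewrite ltn_neqAle eq_sym ne.
  by rewrite -(ler_nat R) => ?; lra.
have c0 := gegenbauer_horner1_gt0 l0 k.
have P0 : 0 < (normGegenbauer R m k)`_k.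
  rewrite /normGegenbauer (negPf ne) coefZ mulr_gt0 ?invr_gt0//.
  exact: gegenbauer_lead_gt0.
have par j : odd (k + j) -> (normGegenbauer R m k)`_j = 0 by exact: normGegenbauer_parity.
apply: (@psd_kernel_fischer _ m k (@zonal m (normGegenbauer R m k) k) _
  ((normGegenbauer R m k)`_k * k`!%:R)).
  by rewrite mulr_gt0// ltr0n fact_gt0.
move=> x y; apply: fischer_zonal => //; apply: lap_zonal => // j.
rewrite /normGegenbauer (negPf ne) !coefZ -mulrA gegenbauer_coefSS.
by field; rewrite gt_eqF.
Qed.

End ZonalKernels.

(** * Positivity of the matrices Y *)

Section ThreePoint.
Variable R : realType.

Lemma dotpC n (x y : 'rV[R]_n) : dotp x y = dotp y x.
Proof. by apply: eq_bigr => i _; rewrite mulrC. Qed.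

Lemma dotp_ge0 n (x : 'rV[R]_n) : 0 <= dotp x x.
Proof. by apply: sumr_ge0 => i _; rewrite -expr2 sqr_ge0. Qed.

Lemma sum_sqr_eq0 (I : finType) (f : I -> R) :
  \sum_i f i * f i = 0 -> forall i, f i = 0.
Proof.
move=> f0 i; have /(_ i isT)/eqP : forall j, true -> f j * f j = 0.
  by apply: psumr_eq0P f0 => j _; rewrite -expr2 sqr_ge0.
by rewrite mulf_eq0 orbb => /eqP.
Qed.

Lemma dotp_sqr_le n (x y : 'rV[R]_n) : dotp x y ^+ 2 <= dotp x x * dotp y y.
Proof.
have E a b : dotp (a *: x + b *: y) (a *: x + b *: y) =
    a ^+ 2 * dotp x x + 2 * a * b * dotp x y + b ^+ 2 * dotp y y.
  rewrite /dotp !mulr_sumr -!big_split; apply: eq_bigr => i _.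
  by rewrite !mxE /=; ring.
have [y0|y0] := eqVneq (dotp y y) 0.
  by rewrite y0 mulr0 /dotp big1 ?expr0n// => i _; rewrite (sum_sqr_eq0 y0) mulr0.
(* This vector is [dotp y y] times the component of [x] orthogonal to [y]. *)
have := dotp_ge0 (dotp y y *: x + (- dotp x y) *: y); rewrite E.
have -> : dotp y y ^+ 2 * dotp x x + 2 * dotp y y * - dotp x y * dotp x y
    + (- dotp x y) ^+ 2 * dotp y y
  = dotp y y * (dotp x x * dotp y y - dotp x y ^+ 2) by ring.
by rewrite pmulr_rge0 ?subr_ge0// lt_def y0 dotp_ge0.
Qed.

(* [H] reflects [e] to the first basis vector and drops that coordinate, so that
   it identifies the orthogonal complement of [e] with [R^n]. *)
Lemma dotp_split n (e : 'rV[R]_n.+1) : dotp e e = 1 ->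
  exists H : 'rV[R]_n.+1 -> 'rV[R]_n,
    forall x y, dotp x y = dotp e x * dotp e y + dotp (H x) (H y).
Proof.
move=> e1; pose a (x : 'rV[R]_n.+1) := (dotp e x - x 0 0) / (e 0 0 - 1).
exists (fun x : 'rV[R]_n.+1 => \row_i (x 0 (lift ord0 i) + a x * e 0 (lift ord0 i))).
pose D (x y : 'rV[R]_n.+1) := \sum_(i < n) x 0 (lift ord0 i) * y 0 (lift ord0 i).
have dE x y : dotp x y = x 0 0 * y 0 0 + D x y by rewrite /dotp big_ord_recl.
have aE x : dotp e x - x 0 0 = a x * (e 0 0 - 1).
  (* If [e] is the first basis vector, division by 0 makes [a] zero, and [H] only drops the first
     coordinate. *)
  have [e01|e01] := eqVneq (e 0 0) 1; last by rewrite divfK// subr_eq0.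
  have De : D e e = 0 by move: e1; rewrite dE e01 mulr1 => /(canRL (addKr _)); rewrite addNr.
  rewrite e01 subrr mulr0 dE e01 mul1r addrAC subrr add0r /D big1// => i _.
  by rewrite (sum_sqr_eq0 De) mul0r.
move=> x y.
have -> : dotp (\row_i (x 0 (lift ord0 i) + a x * e 0 (lift ord0 i)))
    (\row_i (y 0 (lift ord0 i) + a y * e 0 (lift ord0 i))) =
    D x y + a y * D e x + a x * D e y + a x * a y * D e e.
  rewrite /D /dotp !mulr_sumr -!big_split; apply: eq_bigr => i _.
  by rewrite !mxE /=; ring.
have Dx z : D e z = a z * (e 0 0 - 1) + z 0 0 - e 0 0 * z 0 0.
  by rewrite -aE dE; ring.
have De : D e e = 1 - e 0 0 * e 0 0 by rewrite -e1 dE; ring.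
have ex z : dotp e z = a z * (e 0 0 - 1) + z 0 0 by rewrite -aE; ring.
by rewrite De !Dx !ex dE; ring.
Qed.

Lemma normGegenbauer1 m k : (3 <= m)%N -> (normGegenbauer R m k).[1] = 1.
Proof.
move=> m3; rewrite /normGegenbauer gtn_eqF// hornerZ mulVf// gt_eqF//.
apply: gegenbauer_horner1_gt0.
by move: m3; rewrite -(ler_nat R) => ?; lra.
Qed.

Lemma psdmx1 : psdmx (1%:M : 'M[R]_1).
Proof.
split=> [|x]; first by rewrite trmx1.
by rewrite mulmx1 !mxE big_ord1 !mxE -expr2 sqr_ge0.
Qed.

(** The zonal kernel with a 1 by 1 matrix and unit weights; on unit vectors the homogenisation is
    plain evaluation. *)
Lemma gegenbauer_sum_ge0 n k N (c : 'I_N -> 'rV[R]_n) :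
  (2 <= n)%N -> (forall i, dotp (c i) (c i) = 1) ->
  0 <= \sum_i \sum_j (normGegenbauer R n k).[dotp (c i) (c j)].
Proof.
move=> n2 c1; have := psd_kernel_zonal k n2 (fun _ _ => 1) c psdmx1.
rewrite !big_ord1 mxE eqxx; congr (0 <= _); rewrite [LHS]mul1r; apply: eq_bigr => i _.
apply: eq_bigr => j _; rewrite !mul1r !c1 mul1r.
rewrite (horner_coef_wide _ (size_normGegenbauer R n k)).
by apply: eq_bigr => l _; rewrite expr1n mulr1.
Qed.

Lemma omega_ge0 m : 0 <= omega R m.
Proof.
rewrite /omega divr_ge0 ?mulr_ge0 ?powR_ge0// /Gamma.
by apply: Rintegral_ge0 => t _; rewrite mulr_ge0 ?powR_ge0 ?expR_ge0.
Qed.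

Lemma harmdim_ge0 m k : 0 <= harmdim R m k.
Proof. by rewrite subr_ge0 ler_nat leq_bin2l// leq_sub2l. Qed.

Lemma mxdotDr s (A B B' : 'M[R]_s) : mxdot A (B + B') = mxdot A B + mxdot A B'.
Proof. by rewrite /mxdot mulmxDr mxtraceD. Qed.

Lemma mxdotZr s (A B : 'M[R]_s) a : mxdot A (a *: B) = a * mxdot A B.
Proof. by rewrite /mxdot -scalemxAr mxtraceZ. Qed.

Lemma exchange_big4 (I J : finType) (f : I -> I -> J -> J -> R) :
  \sum_p \sum_q \sum_i \sum_j f p q i j = \sum_i \sum_j \sum_p \sum_q f p q i j.
Proof.
transitivity (\sum_(a : I * I) \sum_(b : J * J) f a.1 a.2 b.1 b.2).
  by rewrite pair_big; apply: eq_bigr => a _; rewrite pair_big.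
rewrite exchange_big [RHS]pair_big; apply: eq_bigr => b _.
by rewrite [RHS]pair_big.
Qed.

(** For unit vectors, [t - u v] and [1 - u^2] are inner products of projections to the complement of
    [e], so [Q] is a zonal kernel one dimension lower. The remaining factors of an entry split into
    a nonnegative constant and the weights [z] of the two points. *)
Lemma Ymx_sum_ge0 n d k (F : 'M[R]_((d - k).+1)) (e : 'rV[R]_n)
    N (c : 'I_N -> 'rV[R]_n) :
  (3 <= n)%N -> psdmx F -> dotp e e = 1 -> (forall i, dotp (c i) (c i) = 1) ->
  0 <= \sum_i \sum_j
    mxdot F (Ymx n d k (dotp e (c i)) (dotp e (c j)) (dotp (c i) (c j))).
Proof.
case: n e c => // n e c n3 Fpsd e1 c1.
have [H dH] := dotp_split e1.
pose K (x y : 'rV[R]_n) := homog_eval (normGegenbauer R n k) k (dotp x y) (dotp x x * dotp y y).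
have QK i j : Q n k (dotp e (c i)) (dotp e (c j)) (dotp (c i) (c j)) =
    K (H (c i)) (H (c j)).
  rewrite /Q /K /homog_eval.
  have -> : dotp (H (c i)) (H (c j)) =
      dotp (c i) (c j) - dotp e (c i) * dotp e (c j).
    by rewrite dH; ring.
  have HH x : dotp x x = 1 -> dotp (H x) (H x) = 1 - dotp e x ^+ 2.
    by move=> <-; rewrite dH; ring.
  by rewrite !HH.
pose z (i : 'I_(d - k).+1) l := Num.sqrt (harmdim R (n.+1 + 2 * k) i)
  * (normGegenbauer R (n.+1 + 2 * k) i).[dotp e (c l)].
pose kap : R := omega R n.+1 / omega R n
  * (omega R (n.+1 + 2 * k - 1) / omega R (n.+1 + 2 * k)).
have kap0 : 0 <= kap by apply: mulr_ge0; apply: divr_ge0; exact: omega_ge0.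
have := mulr_ge0 kap0 (psd_kernel_zonal k n3 z (H \o c) Fpsd).
congr (0 <= _); rewrite mulr_sumr.
transitivity (\sum_p \sum_q \sum_i \sum_j
   F p q * (kap * (z p i * z q j * K (H (c i)) (H (c j))))).
  apply: eq_bigr => p _; rewrite mulr_sumr; apply: eq_bigr => q _.
  rewrite mulrCA !mulr_sumr; apply: eq_bigr => i _.
  by rewrite !mulr_sumr; apply: eq_bigr => j _.
rewrite exchange_big4; apply: eq_bigr => i _; apply: eq_bigr => j _.
rewrite /mxdot /mxtrace; under [in RHS]eq_bigr do rewrite mxE.
rewrite [in RHS]exchange_big; apply: eq_bigr => p _; apply: eq_bigr => q _.
(* The trace pairs each entry of [F] with the transposed entry of [Y]. *)
have -> : F p q = F q p by have [Fs _] := Fpsd; rewrite -{1}Fs mxE.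
have n1 : (n.+1 - 1 = n)%N by rewrite subn1.
congr (_ * _); rewrite !mxE /lambdaY n1 QK /= sqrtrM ?harmdim_ge0// /z /kap.
ring.
Qed.

End ThreePoint.

(** * Counting pairs and triples *)

Section Counting.
Variable R : realType.

Lemma sum_delta (I : finType) (i : I) (f : I -> R) :
  \sum_j (i == j)%:R * f j = f i.
Proof.
rewrite (bigD1 i)//= eqxx mul1r big1 ?addr0// => j /negPf ji.
by rewrite eq_sym ji mul0r.
Qed.

(** Here [W] holds the values of [G] on triples with a repeated index. Both nonnegative sums are
    bounded by splitting off coincident indices. *)
Lemma pair_triple_bound (I : finType) (X W : I -> I -> R) (G : I -> I -> I -> R)
    (s h b12 b22 : R) :
  (forall i, X i i = s) -> (forall i, W i i = h) ->
  (forall i j, [/\ G i i j = W i j, G i j i = W i j & G i j j = W i j]) ->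
  (forall i j, i != j -> X i j + 2 * b12 + b22 + 3 * W i j <= -1) ->
  (forall i j l, i != j -> i != l -> j != l -> b22 + G i j l <= 0) ->
  0 <= \sum_i \sum_j X i j -> 0 <= \sum_i \sum_j \sum_l G i j l ->
  0 <= #|I|%:R * (s + h - (#|I|%:R - 1) * (1 + 2 * b12) - b22 * (#|I|%:R - 1) ^+ 2).
Proof.
move=> Xs Wh Gc pairle triple_le X0 G0; set N : R := #|I|%:R.
have sumc (a : R) : \sum_(i : I) a = N * a by rewrite sumr_const mulr_natl.
pose SW := \sum_i \sum_j W i j.
have le2 : \sum_i \sum_j X i j + 3 * SW
    <= N * (s + 3 * h) - (N ^+ 2 - N) * (1 + 2 * b12 + b22).
  rewrite /SW mulr_sumr -big_split /=.
  apply: (@le_trans _ _ (\sum_(i : I) \sum_(j : I) (- (1 + 2 * b12 + b22)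
      + (i == j)%:R * (s + 3 * h + (1 + 2 * b12 + b22))))).
    apply: ler_sum => i _; rewrite mulr_sumr -big_split; apply: ler_sum => j _ /=.
    have [->|ij] := eqVneq i j; first by rewrite Xs Wh mul1r; lra.
    by rewrite mul0r; have := pairle _ _ ij; lra.
  under eq_bigr do rewrite big_split /= sumc sum_delta.
  by rewrite sumc le_eqVlt; apply/orP; left; apply/eqP; ring.
have le3 : \sum_i \sum_j \sum_l G i j l
    <= 3 * SW - 2 * N * h - b22 * (N ^+ 3 - 3 * N ^+ 2 + 2 * N).
  (* Inclusion-exclusion over the coincidences among [i], [j], [l]. *)
  apply: (@le_trans _ _ (\sum_i \sum_j \sum_l
     (- b22 + (i == j)%:R * (b22 + W i l) + (i == l)%:R * (b22 + W i j)
      + (j == l)%:R * (b22 + W i j + (i == j)%:R * (- 2 * h - 2 * b22))))).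
    apply: ler_sum => i _; apply: ler_sum => j _; apply: ler_sum => l _.
    have [Gi _ _] := Gc i l; have [_ Gj Gl] := Gc i j.
    have [ij|ij] := eqVneq i j.
      subst j; rewrite Gi mul1r; have [il|il] := eqVneq i l; last by rewrite !mul0r; lra.
      by subst l; rewrite Wh !mul1r; lra.
    have [il|il] := eqVneq i l.
      by subst l; rewrite Gj [j == i]eq_sym (negPf ij) !mul0r mul1r; lra.
    have [jl|jl] := eqVneq j l; first by subst l; rewrite Gl !mul0r mul1r; lra.
    by rewrite !mul0r; have := triple_le _ _ _ ij il jl; lra.
  rewrite le_eqVlt; apply/orP; left; apply/eqP.
  have inner i j : \sum_l (- b22 + (i == j)%:R * (b22 + W i l)
      + (i == l)%:R * (b22 + W i j)
      + (j == l)%:R * (b22 + W i j + (i == j)%:R * (- 2 * h - 2 * b22))) =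
    (2 - N) * b22 + 2 * W i j + (i == j)%:R * (N * b22 + \sum_l W i l - 2 * h - 2 * b22).
    rewrite !big_split !sum_delta sumc /= -mulr_sumr big_split sumc /=.
    by ring.
  under eq_bigr do under eq_bigr do rewrite inner.
  under eq_bigr do rewrite !big_split /= sum_delta sumc -mulr_sumr.
  rewrite !big_split /= !sumc -!mulr_sumr.
  by rewrite -/SW; rewrite ?sumc; ring.
(* Three kinds of coincidence produce [3 * SW], which the factor 3 in the pair inequality
   cancels. *)
rewrite [leRHS](_ : _ = (N * (s + 3 * h) - (N ^+ 2 - N) * (1 + 2 * b12 + b22) - 3 * SW)
  + (3 * SW - 2 * N * h - b22 * (N ^+ 3 - 3 * N ^+ 2 + 2 * N))); last by ring.
by lra.
Qed.

End Counting.

(** * Symmetry and positivity of the three-point function *)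

Section Bound.
Variable R : realType.

(** The Gram determinant is the Cauchy-Schwarz defect of the projections of [y] and [z] to the
    complement of [x]. *)
Lemma gram3_ge0 n (x y z : 'rV[R]_n) :
  dotp x x = 1 -> dotp y y = 1 -> dotp z z = 1 ->
  0 <= 1 + 2 * dotp x y * dotp x z * dotp y z
       - dotp x y ^+ 2 - dotp x z ^+ 2 - dotp y z ^+ 2.
Proof.
case: n x y z => [|n] x y z x1 y1 z1.
  by move: x1; rewrite /dotp big_ord0 => /esym/eqP; rewrite oner_eq0.
have [H dH] := dotp_split x1; have := dotp_sqr_le (H y) (H z).
have E u v : dotp (H u) (H v) = dotp u v - dotp x u * dotp x v by rewrite (dH u v); ring.
by rewrite !E y1 z1 -subr_ge0; congr (0 <= _); ring.
Qed.

Lemma Smx_swap12 n d k (u v t : R) : Smx n d k u v t = Smx n d k v u t.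
Proof.
rewrite /Smx; congr (_ *: _).
do 6 move: (Ymx n d k _ _ _) => ?.
by apply/matrixP => i j; rewrite !mxE; ring.
Qed.

Lemma Smx_swap23 n d k (u v t : R) : Smx n d k u v t = Smx n d k u t v.
Proof.
rewrite /Smx; congr (_ *: _).
do 6 move: (Ymx n d k _ _ _) => ?.
by apply/matrixP => i j; rewrite !mxE; ring.
Qed.

(** At this point [t - u v] and [1 - u^2] vanish, and for [k > 0] each term of [Q] contains one of
    them or has zero coefficient by parity. *)
Lemma Smx111_eq0 n d k : (0 < k)%N -> Smx n d k 1 1 1 = 0 :> 'M[R]_((d - k).+1).
Proof.
move=> k0; have Y0 : Ymx n d k 1 1 1 = 0 :> 'M[R]_((d - k).+1).
  apply/matrixP => i j; rewrite !mxE [Q _ _ _ _ _](_ : _ = 0) ?mulr0//.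
  rewrite /Q big1// => -[[|l] /= lk] _; last by rewrite mul1r subrr exprS !(mul0r, mulr0).
  have [od|ev] := boolP (odd (k + 0)); first by rewrite normGegenbauer_parity// !mul0r.
  have : (0 < (k - 0)./2)%N by lia.
  by case: (_./2) => // h _; rewrite expr1n subrr mul0r exprS !mul0r mulr0.
by rewrite /Smx Y0 !addr0 scaler0.
Qed.

Section ThreePointSum.
Variables (n d : nat) (F : forall k : 'I_d.+1, 'M[R]_((d - k).+1)).
Hypothesis (n3 : (3 <= n)%N) (Fpsd : forall k, psdmx (F k)).

Definition three_point (u v t : R) : R := \sum_(k < d.+1) mxdot (F k) (Smx n d k u v t).

Lemma three_point_swap12 u v t : three_point u v t = three_point v u t.
Proof. by apply: eq_bigr => k _; rewrite Smx_swap12. Qed.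

Lemma three_point_swap23 u v t : three_point u v t = three_point u t v.
Proof. by apply: eq_bigr => k _; rewrite Smx_swap23. Qed.

Lemma three_point111 : three_point 1 1 1 = mxdot (F ord0) (Smx n d 0 1 1 1).
Proof.
rewrite /three_point big_ord_recl big1 ?addr0// => k _.
by rewrite Smx111_eq0// /mxdot mulmx0 mxtrace0.
Qed.

(** Permuting [u], [v], [t] amounts to relabelling the three points, so all six summands of [Smx]
    have the same total [T]. It is nonnegative by [Ymx_sum_ge0] with each [c i] in turn as base
    point. *)
Lemma three_point_sum_ge0 N (c : 'I_N -> 'rV[R]_n) :
  (forall i, dotp (c i) (c i) = 1) ->
  0 <= \sum_i \sum_j \sum_l
         three_point (dotp (c i) (c j)) (dotp (c i) (c l)) (dotp (c j) (c l)).
Proof.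
move=> c1; rewrite [leRHS](_ : _ = \sum_(k < d.+1) \sum_i \sum_j \sum_l
    mxdot (F k) (Smx n d k (dotp (c i) (c j)) (dotp (c i) (c l)) (dotp (c j) (c l))));
    last first.
  rewrite [RHS]exchange_big; apply: eq_bigr => i _.
  by rewrite [RHS]exchange_big; apply: eq_bigr => j _; rewrite exchange_big.
apply: sumr_ge0 => k _.
pose G i j l := mxdot (F k)
  (Ymx n d k (dotp (c i) (c j)) (dotp (c i) (c l)) (dotp (c j) (c l))).
pose T := \sum_i \sum_j \sum_l G i j l.
have T0 : 0 <= T.
  by apply: sumr_ge0 => i _; exact: Ymx_sum_ge0 (Fpsd k) (c1 i) c1.
have swap12 (g : 'I_N -> 'I_N -> 'I_N -> R) :
    \sum_i \sum_j \sum_l g j i l = \sum_i \sum_j \sum_l g i j l.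
  by rewrite exchange_big.
have swap23 (g : 'I_N -> 'I_N -> 'I_N -> R) :
    \sum_i \sum_j \sum_l g i l j = \sum_i \sum_j \sum_l g i j l.
  by apply: eq_bigr => i _; rewrite exchange_big.
rewrite [leRHS](_ : _ = T)//.
rewrite [LHS](_ : _ = \sum_i \sum_j \sum_l 6^-1 *
  (G i j l + G j i l + G i l j + G l i j + G j l i + G l j i)); last first.
  apply: eq_bigr => i _; apply: eq_bigr => j _; apply: eq_bigr => l _.
  rewrite /Smx mxdotZr !mxdotDr /G.
  rewrite (dotpC (c j) (c i)) (dotpC (c l) (c i)) (dotpC (c l) (c j)).
  by congr (_ * _); ring.
transitivity (6^-1 * (T + T + T + T + T + T)); last by field.
under eq_bigr do (under eq_bigr do rewrite -mulr_sumr; rewrite -mulr_sumr).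
rewrite -mulr_sumr; congr (_ * _).
transitivity (T + \sum_i \sum_j \sum_l G j i l + \sum_i \sum_j \sum_l G i l j
  + \sum_i \sum_j \sum_l G l i j + \sum_i \sum_j \sum_l G j l i
  + \sum_i \sum_j \sum_l G l j i).
  rewrite /T -!big_split; apply: eq_bigr => i _.
  by rewrite -!big_split; apply: eq_bigr => j _; rewrite -!big_split.
congr (_ + _ + _ + _ + _ + _).
- exact: swap12 G.
- exact: swap23 G.
- by rewrite (swap23 (fun i j l => G j i l)) (swap12 G).
- by rewrite (swap12 (fun i j l => G i l j)) (swap23 G).
- by rewrite (swap12 (fun i j l => G l i j)) (swap23 (fun i j l => G j i l)) (swap12 G).
Qed.

Lemma three_point_sorted (b m : R) :
  (forall u v t : R, -1 <= u -> u <= v -> v <= t -> t <= m ->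
     0 <= 1 + 2 * u * v * t - u ^+ 2 - v ^+ 2 - t ^+ 2 ->
     b + three_point u v t <= 0) ->
  forall u v t : R, -1 <= u <= m -> -1 <= v <= m -> -1 <= t <= m ->
     0 <= 1 + 2 * u * v * t - u ^+ 2 - v ^+ 2 - t ^+ 2 ->
     b + three_point u v t <= 0.
Proof.
move=> H u v t.
wlog uv : u v / u <= v => [W|] /andP[u1 um] /andP[v1 vm] /andP[t1 tm] det.
  have [uv|/ltW vu] := leP u v; first by apply: W => //; apply/andP.
  rewrite three_point_swap12; apply: W => //; try exact/andP.
  by move: det; congr (0 <= _); ring.
have [vt|/ltW tv] := leP v t; first exact: H.
rewrite three_point_swap23; have [ut|/ltW tu] := leP u t.
  by apply: H => //; move: det; congr (0 <= _); ring.
by rewrite three_point_swap12; apply: H => //; move: det; congr (0 <= _); ring.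
Qed.

End ThreePointSum.
End Bound.

(** * The bound on the size of a spherical code *)

Theorem theorem4p2 (R : realType) (n d : nat) (theta : R)
    (a : nat -> R) (b11 b12 b22 : R)
    (F : forall k : 'I_d.+1, 'M[R]_((d - k).+1)) :
  (3 <= n)%N -> (1 <= d)%N -> 0 < theta <= pi ->
  psdmx (block_mx b11%:M b12%:M b12%:M b22%:M : 'M[R]_(1 + 1)) ->
  (forall k, (1 <= k <= d)%N -> 0 <= a k) ->
  (forall k, psdmx (F k)) ->
  (forall u : R, -1 <= u <= cos theta ->
     \sum_(1 <= k < d.+1) a k * (normGegenbauer R n k).[u] + 2 * b12 + b22
       + 3 * \sum_(k < d.+1) mxdot (F k) (Smx n d k u u 1) <= -1) ->
  (forall u v t : R, -1 <= u -> u <= v -> v <= t -> t <= cos theta ->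
     0 <= 1 + 2 * u * v * t - u ^+ 2 - v ^+ 2 - t ^+ 2 ->
     b22 + \sum_(k < d.+1) mxdot (F k) (Smx n d k u v t) <= 0) ->
  (max_code_card n theta)%:R <=
    1 + \sum_(1 <= k < d.+1) a k + b11 + mxdot (F ord0) (Smx n d 0 1 1 1).
Proof.
move=> n3 _ thetab [_ Bpos] a0 Fpsd pair_ineq triple_ineq.
(* The quadratic form at the vector [(1, s)]; later [s] is 0 or [N - 1]. *)
have Bq s : 0 <= b11 + 2 * b12 * s + b22 * s ^+ 2.
  have := Bpos (row_mx 1%:M s%:M).
  rewrite tr_row_mx !tr_scalar_mx mul_row_block mul_row_col.
  rewrite -!scalar_mxM -!raddfD -!scalar_mxM -raddfD mxE eqxx.
  by congr (0 <= _); rewrite mulr1n; ring.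
have Fsum N (c : 'I_N -> 'rV[R]_n) := three_point_sum_ge0 n3 Fpsd (c := c).
set h := mxdot _ _; pose H := three_point n F.
have HE : H 1 1 1 = h by exact: three_point111.
(* [h] is the three-point sum of a one-point code, here the first basis vector. *)
have h0 : 0 <= h.
  pose x : 'rV[R]_n := delta_mx 0 (Ordinal (leq_trans (isT : 0 < 3)%N n3)).
  have x1 : dotp x x = 1.
    rewrite /dotp /x (bigD1 (Ordinal (leq_trans (isT : 0 < 3)%N n3)))//= !mxE !eqxx mul1r.
    by rewrite big1 ?addr0// => i /negPf; rewrite mxE eqxx => ->; rewrite mul0r.
  by have := Fsum 1%N (fun=> x) (fun=> x1); rewrite !big_ord1 x1 -/H HE.
have [[C [Csph Cdot] CN] _] := max_code_cardP n thetab.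
move: (max_code_card n theta) CN => N CN.
have /card_bijP[c /bij_inj cinj] := card_esym CN.
have iN (i : 'I_N) : (val i) \in (`I_N)%classic by rewrite inE /= ltn_ord.
pose e (i : 'I_N) : 'rV[R]_n := set_val (c (exist _ (val i) (iN i))).
have eC i : C (e i) by exact: set_valP.
have e1 i : dotp (e i) (e i) = 1 by exact: Csph.
have edot i j : i != j -> -1 <= dotp (e i) (e j) <= cos theta.
  move=> ij; apply/andP; split.
    by have := dotp_sqr_le (e i) (e j); rewrite !e1; nra.
  apply: Cdot => // eij; move/eqP: ij; apply; apply: val_inj.
  by have /cinj/(congr1 val) := val_inj eij.
pose X i j := \sum_(1 <= k < d.+1) a k * (normGegenbauer R n k).[dotp (e i) (e j)].
pose sa := \sum_(1 <= k < d.+1) a k.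
have sa0 : 0 <= sa by rewrite /sa big_nat; apply: sumr_ge0 => k; exact: a0.
have X0 : 0 <= \sum_i \sum_j X i j.
  rewrite (_ : \sum_i _ = \sum_(1 <= k < d.+1) a k *
    \sum_i \sum_j (normGegenbauer R n k).[dotp (e i) (e j)]); last first.
    under [RHS]eq_bigr do rewrite mulr_sumr.
    rewrite [RHS]exchange_big; apply: eq_bigr => i _.
    under [RHS]eq_bigr do rewrite mulr_sumr.
    by rewrite [RHS]exchange_big.
  rewrite big_nat; apply: sumr_ge0 => k k1; rewrite mulr_ge0 ?a0//.
  exact: gegenbauer_sum_ge0 (ltnW n3) e1.
have hN : 0 <= N%:R * (sa + h - (N%:R - 1) * (1 + 2 * b12) - b22 * (N%:R - 1) ^+ 2).
  rewrite -[N in N%:R]card_ord.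
  apply: (@pair_triple_bound R 'I_N X
    (fun i j => H (dotp (e i) (e j)) (dotp (e i) (e j)) 1)
    (fun i j l => H (dotp (e i) (e j)) (dotp (e i) (e l)) (dotp (e j) (e l)))) => //.
  - by move=> i; apply: eq_bigr => k _; rewrite e1 normGegenbauer1// mulr1.
  - by move=> i; rewrite e1.
  - move=> i j; rewrite !e1 (dotpC (e j) (e i)) /H; split=> //.
      by rewrite three_point_swap12 three_point_swap23.
    by rewrite three_point_swap23.
  - by move=> i j ij; exact: pair_ineq (edot _ _ ij).
  - move=> i j l ij il jl.
    apply: (three_point_sorted triple_ineq); try exact: edot.
    exact: gram3_ge0.
  exact: Fsum e1.
rewrite -/sa; have b11_ge0 : 0 <= b11 by have := Bq 0; rewrite expr0n !mulr0 !addr0.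
(* For [N = 0] the right-hand side is a sum of nonnegative terms; otherwise [hN] can be divided by
   [N]. *)
have [->|N0] := posnP N; first by lra.
have Npos : (0 : R) < N%:R by rewrite ltr0n.
(* Adding the two inequalities cancels [b12] and [b22]. *)
by move: hN; rewrite pmulr_rge0//; have := Bq (N%:R - 1); lra.
Qed.
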